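(* Let $K=[\beta_1,\beta_2]$ with $\beta_1<\beta_2$ and either $K\subset(0,\infty)$ or $K\subset(-\infty,0)$. Let $A\in\mathbb{R}^{n\times n}$ and $B\in\mathbb{R}^{n\times m}$ be constant matrices with $\mathrm{rank}(A)=n$ and $\mathrm{rank}(B)=m<n$, and consider the time-invariant linear ensemble system $$\frac{d}{dt}X(t,\beta)=\beta AX(t,\beta)+BU(t),\qquad \beta\in K,$$ with $X(t,\beta)\in\mathbb{R}^n$ and piecewise continuous controls $U:[0,T]\to\mathbb{R}^m$. Suppose that $A$ is diagonalizable with real eigenvalues, $A=PJP^{-1}$ with $J=\mathrm{diag}(\lambda_1,\dots,\lambda_n)$, $\lambda_i\in\mathbb{R}$, where the eigenvalues and eigenvectors are ordered so that the $m\times m$ matrix $B_0$ formed by the first $m$ rows of $P^{-1}B$ is invertible. Put $\widetilde B=P^{-1}BB_0^{-1}\in\mathbb{R}^{n\times m}$ (whose first $m$ rows form the identity matrix), so that $Y=P^{-1}X$ and $V=B_0U$ satisfy $\frac{d}{dt}Y(t,\beta)=\beta JY(t,\beta)+\widetilde BV(t)$. For $k=m+1,\dots,n$ let $S_k=\{j\in\{1,\dots,m\}:\widetilde B_{kj}\neq0\}$. Let $\bar{\mathcal{A}}$ and, for each $\mathcal{A}_r\in\bar{\mathcal{A}}$, the matrix $\overline M_r\in\mathbb{R}^{p_r\times m}$ be the objects defined in the context from $J$, $K$ and $\widetilde B$. Then the system is uniformly ensemble controllable if and only if (i) $S_k\neq\emptyset$ for all $k=m+1,\dots,n$, and (ii)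 either $\bar{\mathcal{A}}=\emptyset$, or $\bar{\mathcal{A}}\neq\emptyset$ and for every $\mathcal{A}_r\in\bar{\mathcal{A}}$, $$\mathrm{rank}(\overline M_r)=p_r\le m.$$
   Context: $C^n(K)$ is the space of $n$-tuples of continuous real functions on $K$. Uniform ensemble controllability (on $C^n(K)$): for all $X_0,X_F\in C^n(K)$ and every $\varepsilon>0$ there exist a finite time $T>0$ (which may depend on $\varepsilon$) and a piecewise continuous control $U:[0,T]\to\mathbb{R}^m$, not depending on $\beta$, such that the solution with $X(0,\beta)=X_0(\beta)$ for all $\beta\in K$ satisfies $\sup_{\beta\in K}\|X(T,\beta)-X_F(\beta)\|<\varepsilon$. Spectra and their overlaps. For $i=1,\dots,n$ let $\sigma_i=\lambda_iK=\{\lambda_i\beta:\beta\in K\}$, a compact interval. Let $\mathcal{A}=\{\mathcal{A}_k\}$ be the collection of pairwise disjoint nonempty sets obtained by partitioning the union of all intersections of two or more of the $\sigma_i$ (indices distinct) according to which $\sigma_j$ contain a given point: for each index set $I\subset\{1,\dots,n\}$ with $|I|\ge2$ such that $\{x\in\mathbb{R}:\{j:x\in\sigma_j\}=I\}$ is nonempty, this set is a member of $\mathcal{A}$. For $\mathcal{A}_k\in\mathcal{A}$ let $\chi_k=\{j\in\{1,\dots,n\}:\mathcal{A}_k\subset\sigma_j\}$. Put $$\bar{\mathcal{A}}=\{\mathcal{A}_r\in\mathcal{A}:\max\chi_r>m\}.$$ The matrices $\overline M_r$. For $\mathcal{A}_r\in\bar{\mathcal{A}}$ let $E_r$ be the $n\times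 n$ diagonal matrix whose $i$-th diagonal entry is $1$ if $i\in\chi_r$ and $0$ if $i\notin\chi_r$. Let $M_r=E_r\widetilde B\in\mathbb{R}^{n\times m}$, and let $\overline M_r\in\mathbb{R}^{p_r\times m}$, $p_r\le n$, be the matrix obtained from $M_r$ by deleting its zero rows (so $p_r$ is the number of nonzero rows of $M_r$). *)

(* Defs.v *)
From HB Require Import structures.
From mathcomp Require Import all_boot all_order all_algebra.
From mathcomp Require Import all_classical all_reals all_analysis.

Set Implicit Arguments.
Unset Strict Implicit.
Unset Printing Implicit Defensive.

Import Order.TTheory GRing.Theory Num.Theory.
Import numFieldNormedType.Exports.

Local Open Scope classical_set_scope.
Local Open Scope ring_scope.

(* The library norm of a matrix is the max norm; this is the Euclidean one. *)
Definition enorm (R : realType) (n : nat) (v : 'cV[R]_n) : R :=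
  Num.sqrt (\sum_(i < n) v i ord0 ^+ 2).

(* Finitely many subintervals, with U continuous inside each of them and with
   finite one-sided limits at their endpoints; the values at the breakpoints
   and outside [0, T] are arbitrary. *)
Definition piecewise_continuous (R : realType) (m : nat) (T : R)
    (U : R -> 'cV[R]_m) : Prop :=
  exists2 s : seq R, itv_partition 0 T s &
    forall k : nat, (k < size s)%N ->
      let a := nth 0 (0 :: s) k in
      let b := nth 0 s k in
      [/\ {in `]a, b[, continuous U},
          cvg (U t @[t --> a^'+])
        & cvg (U t @[t --> b^'-])].

(* Solution on [0, T] of x' = beta A x + B U, x(0) = x0, for a piecewise
   continuous U: x is continuous on [0, T] and the equation holds at every
   interior time at which U is continuous, i.e. off finitely many times. *)
Definition is_solution (R : realType) (n m : nat) (A : 'M[R]_n)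
    (B : 'M[R]_(n, m)) (T beta : R) (U : R -> 'cV[R]_m) (x0 : 'cV[R]_n)
    (x : R -> 'cV[R]_n) : Prop :=
  [/\ {within `[0, T], continuous x},
      x 0 = x0
    & forall t : R, 0 < t < T -> {for t, continuous U} ->
        is_derive t 1 x (beta *: (A *m x t) + B *m U t)].

(* For given U and X0 the solution exists and is unique on [0, T], so that
   quantifying X existentially names that solution. The supremum is taken in
   the extended reals, where it is meaningful for unbounded sets too. *)
Definition uniformly_ensemble_controllable (R : realType) (n m : nat)
    (K : set R) (A : 'M[R]_n) (B : 'M[R]_(n, m)) : Prop :=
  forall X0 XF : R -> 'cV[R]_n,
    {within K, continuous X0} -> {within K, continuous XF} ->
    forall eps : R, 0 < eps ->
    exists T : R, 0 < T /\
    exists U : R -> 'cV[R]_m, piecewise_continuous T U /\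
    exists X : R -> R -> 'cV[R]_n,
      (forall beta : R, K beta ->
         is_solution A B T beta U (X0 beta) (fun t => X t beta)) /\
      (ereal_sup [set (enorm (X T beta - XF beta))%:E | beta in K]
         < eps%:E)%E.

Definition top_rows (R : realType) (n m : nat) (hmn : (m < n)%N)
    (M : 'M[R]_(n, m)) : 'M[R]_m :=
  rowsub (widen_ord (ltnW hmn)) M.

Definition B0 (R : realType) (n m : nat) (hmn : (m < n)%N) (P : 'M[R]_n)
    (B : 'M[R]_(n, m)) : 'M[R]_m :=
  top_rows hmn (invmx P *m B).

Definition Btilde (R : realType) (n m : nat) (hmn : (m < n)%N) (P : 'M[R]_n)
    (B : 'M[R]_(n, m)) : 'M[R]_(n, m) :=
  invmx P *m B *m invmx (B0 hmn P B).

Definition row_support (R : realType) (n m : nat) (Bt : 'M[R]_(n, m))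
    (k : 'I_n) : {set 'I_m} :=
  [set j | Bt k j != 0]%SET.

Definition spectrum (R : realType) (n : nat) (K : set R) (lam : 'rV[R]_n)
    (i : 'I_n) : set R :=
  [set lam ord0 i * beta | beta in K].

Definition overlap_set (R : realType) (n : nat) (K : set R) (lam : 'rV[R]_n)
    (I : {set 'I_n}) : set R :=
  [set x | forall j : 'I_n, spectrum K lam j x <-> j \in I].

Definition overlaps (R : realType) (n : nat) (K : set R) (lam : 'rV[R]_n) :
    set (set R) :=
  [set S | exists I : {set 'I_n},
     [/\ (2 <= #|I|)%N, overlap_set K lam I !=set0 & S = overlap_set K lam I]].

Definition chi (R : realType) (n : nat) (K : set R) (lam : 'rV[R]_n)
    (S : set R) : {set 'I_n} :=
  [set j | `[< S `<=` spectrum K lam j >]]%SET.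

(* 'I_n is 0-based, so j.+1 is the index of j in {1, ..., n}. *)
Definition overlaps_bar (R : realType) (n m : nat) (K : set R)
    (lam : 'rV[R]_n) : set (set R) :=
  [set S | overlaps K lam S /\ (m < \max_(j in chi K lam S) j.+1)%N].

Definition Emx (R : realType) (n : nat) (I : {set 'I_n}) : 'M[R]_n :=
  diag_mx (\row_(i < n) (i \in I)%:R).

Definition nonzero_rows (R : realType) (n m : nat) (M : 'M[R]_(n, m)) :
    {set 'I_n} :=
  [set i | row i M != 0]%SET.

Definition delete_zero_rows (R : realType) (n m : nat) (M : 'M[R]_(n, m)) :
    'M[R]_(#|nonzero_rows M|, m) :=
  rowsub (fun k => enum_val k) M.

Definition Mr (R : realType) (n m : nat) (K : set R) (lam : 'rV[R]_n)
    (Bt : 'M[R]_(n, m)) (S : set R) : 'M[R]_(n, m) :=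
  Emx R (chi K lam S) *m Bt.

Definition pr (R : realType) (n m : nat) (K : set R) (lam : 'rV[R]_n)
    (Bt : 'M[R]_(n, m)) (S : set R) : nat :=
  #|nonzero_rows (Mr K lam Bt S)|.

Definition Mbar (R : realType) (n m : nat) (K : set R) (lam : 'rV[R]_n)
    (Bt : 'M[R]_(n, m)) (S : set R) : 'M[R]_(pr K lam Bt S, m) :=
  delete_zero_rows (Mr K lam Bt S).

(* Main.v *)
Require Import Defs.
From HB Require Import structures.
From mathcomp Require Import all_boot all_order all_algebra.
From mathcomp Require Import all_classical all_reals all_analysis.
From mathcomp Require Import zify ring lra.

Import Order.TTheory GRing.Theory Num.Theory.
Import numFieldNormedType.Exports.

Local Open Scope classical_set_scope.
Local Open Scope ring_scope.

(** In the coordinates Y = P^-1 X the ensemble splits into the scalar equations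
    y_i' = lam_i beta y_i + (Bt V)_i, coupled only through the control. The
    equation of index i at the parameter beta depends on x = lam_i beta alone:
    from rest, its state at time T is the i-th entry of Bt g(x), where g_j(x)
    is the response to V_j of the scalar equation y' = x y + v. So, writing
    sigma_i for the spectrum lam_i K, the question is whether the tuples
    of functions (Bt g)_i restricted to sigma_i are uniformly dense in the
    product of the spaces C(sigma_i), when g ranges over the responses.

    The answer is a condition at each point ([pointwise_free]): for every real
    x, the rows of Bt whose spectrum contains x are linearly independent.

    The condition is necessary ([controllable_pointwise_free]): if
    sum_i c_i Bt_i = 0 over the spectra through x, then z = sum_i c_i y_i,
    each y_i being taken at the parameter with lam_i beta = x, solves z' = x z
    whatever the control is. Hence z stays at 0 when it starts at 0, and a
    target with z different from 0 cannot be approached.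

    The condition is sufficient ([pointwise_free_controllable]), in two steps.
    - Every tuple of continuous h_i on sigma_i is a uniform limit of
      (Bt p)_i with p a vector of polynomials ([vector_weierstrass]). Near a
      point t only spectra having a common point occur, by Helly's theorem on
      the line, so that independence lets one solve (Bt g(t))_i = h_i(t) for
      all of them. The solution g is bounded but may jump with t. Bernstein
      polynomials of g still work: they average values of g near x, and there
      (Bt g)_i is close to h_i(x).
    - Every polynomial is, uniformly on bounded sets of nonzero x, a limit of
      responses at time 1 ([scalar_realization]). Piecewise linear controls
      with kinks at multiples of 1/M have among their responses the
      polynomials in w = exp(x/M) with a double root at 1, divided by x^2,
      while M (w - 1) tends to x.
    The time horizon 1 is fixed in advance, so that the free motion of the
    initial state can be subtracted from the target before approximating.

    It remains to see that the pointwise condition is the conjunction of the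
    two conditions on the matrices ([pointwise_freeP]). At a point of a
    single spectrum it says that a row is nonzero; at a point of several
    spectra with indices among the first m it holds since the first m rows of
    Bt form the identity; at the other points it is the rank condition. *)

Set Implicit Arguments.
Unset Strict Implicit.
Unset Printing Implicit Defensive.

(** * Bernstein polynomials *)

(** The Bernstein polynomial of degree d with the values f k at the nodes k / d,
    defined by de Casteljau's recursion. In probabilistic terms one of d
    independent trials is split off, and the identities below become
    inductions without any binomial coefficient. *)
Fixpoint bernstein (R : nzRingType) (d : nat) (f : nat -> R) : {poly R} :=
  if d is d'.+1 then
    (1 - 'X) * bernstein d' f + 'X * bernstein d' (fun k => f k.+1)
  else (f 0%N)%:P.

Section Bernstein.
Variable R : realType.
Implicit Types (d k : nat) (f g : nat -> R) (u a : R).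

Lemma bernsteinS d f u :
  (bernstein d.+1 f).[u] =
  (1 - u) * (bernstein d f).[u] + u * (bernstein d (fun k => f k.+1)).[u].
Proof. by rewrite /= !hornerE. Qed.

Lemma bernstein_affine d f u (c a : R) :
  (bernstein d (fun k => c * f k + a)).[u] = c * (bernstein d f).[u] + a.
Proof.
elim: d f => [|d IH] f; first by rewrite /= !hornerC.
by rewrite !bernsteinS (IH f) (IH (fun k => f k.+1)); ring.
Qed.

Lemma bernstein_sum d (I : finType) (F : I -> nat -> R) (c : I -> R) u :
  (bernstein d (fun k => \sum_i c i * F i k)).[u] =
  \sum_i c i * (bernstein d (F i)).[u].
Proof.
elim: d F => [|d IH] F.
  by rewrite /= hornerC; apply: eq_bigr => i _; rewrite hornerC.
rewrite bernsteinS (IH F) (IH (fun i k => F i k.+1)) !mulr_sumr -big_split /=.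
by apply: eq_bigr => i _; rewrite !hornerE /=; ring.
Qed.

Lemma bernstein_le d f g u : 0 <= u <= 1 ->
  (forall k, (k <= d)%N -> f k <= g k) ->
  (bernstein d f).[u] <= (bernstein d g).[u].
Proof.
move=> /andP[u0 u1]; elim: d f g => [|d IH] f g fg.
  by rewrite /= !hornerC fg.
rewrite !bernsteinS lerD// ler_wpM2l ?subr_ge0//; apply: IH => k kd.
  exact/fg/(leq_trans kd).
exact: fg.
Qed.

(** Variance of a binomial law: the value at u is the expectation of
    (N - a)^2 for N binomial with parameters d and u. *)
Lemma bernstein_square d a u :
  (bernstein d (fun k => (k%:R - a) ^+ 2)).[u] =
  (d%:R * u - a) ^+ 2 + d%:R * (u * (1 - u)).
Proof.
elim: d a => [|d IH] a; first by rewrite /= hornerC; ring.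
rewrite bernsteinS IH.
have -> : (fun k => (k.+1%:R - a) ^+ 2) =
    (fun k => (k%:R - (a - 1)) ^+ 2) :> (nat -> R).
  by apply/funext => k; rewrite -natr1; congr (_ ^+ 2); ring.
by rewrite IH -natr1; ring.
Qed.

(** Chebyshev's argument: |f k - a| lies below e plus a parabola centred at
    d * u, and the mean of that parabola is a multiple of the variance
    d * u * (1 - u). No continuity of f is involved, only its values near u;
    this is what allows a discontinuous interpolation below. *)
Lemma bernstein_approx d f a u (e M delta : R) : (0 < d)%N ->
  0 <= u <= 1 -> 0 < delta -> 0 <= e -> 0 <= M ->
  (forall k, (k <= d)%N -> `|k%:R / d%:R - u| < delta -> `|f k - a| <= e) ->
  (forall k, (k <= d)%N -> `|f k - a| <= M) ->
  `|(bernstein d f).[u] - a| <= e + M / (d%:R * delta ^+ 2).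
Proof.
move=> d0 u01 delta0 e0 M0 near_e far_M.
have dR : 0 < d%:R :> R by rewrite ltr0n.
(* The parabola with coefficient w reaches M at distance delta from u. *)
pose w := M / (d%:R * delta) ^+ 2.
have w0 : 0 <= w by rewrite divr_ge0// exprn_ge0// mulr_ge0// ltW.
have pt k : (k <= d)%N -> `|f k - a| <= w * (k%:R - d%:R * u) ^+ 2 + e.
  move=> kd; have [kn|kf] := ltP `|k%:R / d%:R - u| delta.
    by apply: ler_wpDl; rewrite ?near_e// mulr_ge0// sqr_ge0.
  apply: ler_wpDr => //; rewrite (le_trans (far_M _ kd))//.
  rewrite /w mulrAC ler_pdivlMr ?exprn_gt0 ?mulr_gt0// ler_wpM2l//.
  have -> : k%:R - d%:R * u = d%:R * (k%:R / d%:R - u) :> R by field; lra.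
  rewrite !exprMn; apply: ler_wpM2l; first by rewrite exprn_ge0// ltW.
  rewrite -[leRHS]real_normK ?num_real// lerXn2r ?nnegrE//.
  exact: ltW.
have up : w * (bernstein d (fun k => (k%:R - d%:R * u) ^+ 2)).[u] + e
    <= e + M / (d%:R * delta ^+ 2).
  rewrite bernstein_square subrr expr0n /= add0r addrC lerD2l.
  have -> : M / (d%:R * delta ^+ 2) = w * d%:R by rewrite /w; field; lra.
  rewrite ler_wpM2l// ler_piMr ?ltW//; nra.
rewrite -bernstein_affine in up.
rewrite ler_norml lerBrDl lerBlDr; apply/andP; split.
  have : (bernstein d (fun k =>
      -1 * (w * (k%:R - d%:R * u) ^+ 2 + e) + a)).[u] <= (bernstein d f).[u].
    apply: bernstein_le => // k kd.
    by have := pt k kd; rewrite ler_norml => /andP[]; lra.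
  rewrite bernstein_affine; lra.
have : (bernstein d f).[u] <= (bernstein d (fun k =>
      1 * (w * (k%:R - d%:R * u) ^+ 2 + e) + a)).[u].
  apply: bernstein_le => // k kd.
  by have := pt k kd; rewrite ler_norml => /andP[]; lra.
rewrite bernstein_affine; lra.
Qed.

End Bernstein.

(** * Weierstrass approximation under a matrix *)

(** Independence, at every point x, of the rows i of Bt such that x lies in
    sigma i: a dependence is a row vector c supported by those i. Quantifying
    over c avoids extracting submatrices of varying size. *)
Definition pointwise_free (R : realType) (n m : nat)
    (sigma : 'I_n -> set R) (Bt : 'M[R]_(n, m)) : Prop :=
  forall (x : R) (c : 'rV[R]_n),
    (forall i, c ord0 i != 0 -> sigma i x) -> c *m Bt = 0 -> c = 0.

Section VectorWeierstrass.
Variable R : realType.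

Lemma continuous_uniform_on_itv (f : R -> R) (a b e : R) :
  continuous f -> 0 < e ->
  \forall d \near 0^'+, forall x t, a <= x <= b -> `|x - t| < d ->
    `|f x - f t| <= e.
Proof.
move=> fc e0.
have := (compact_near_coveringP _).1 (@segment_compact R a b).
move=> /(_ R (0 : R)^'+
  (fun d x => forall t, `|x - t| < d -> `|f x - f t| <= e)) H.
near=> d => x t xab; move: x xab t.
suff: `[a, b]%classic `<=`
    (fun x => forall t, `|x - t| < d -> `|f x - f t| <= e).
  by move=> + x xab; apply; rewrite /= in_itv.
near: d; apply: H => x _.
have /cvgrPdist_lt /(_ _ (divr_gt0 e0 (ltr0n _ 2))) [eta /= eta0 feta] := fc x.
exists (ball x (eta / 2), [set d | 0 < d < eta / 2]).
  split; first by apply: nbhsx_ballx; rewrite divr_gt0.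
  near=> d => /=; apply/andP; split => //.
  by near: d; apply: nbhs_right_lt; rewrite divr_gt0.
move=> [y d] [/= xy /andP[d0 dl]] t yt.
rewrite -[leLHS](_ : `|(f x - f t) - (f x - f y)| = _); last first.
  by congr `|_|; ring.
rewrite (le_trans (ler_normB _ _))// (splitr e) lerD// ltW// feta /ball_//=.
  rewrite -[ltLHS](_ : `|(x - y) + (y - t)| = _); last by congr `|_|; ring.
  rewrite (le_lt_trans (ler_normD _ _))//.
  have : `|x - y| < eta / 2 by exact: xy.
  lra.
have : `|x - y| < eta / 2 by exact: xy.
lra.
Unshelve. all: by end_near. Qed.

(** Independent rows make the corresponding subsystem of Bt g = r solvable,
    by a linear choice of g. *)
Lemma masked_right_inverse (n m : nat) (Bt : 'M[R]_(n, m)) (J : {set 'I_n}) :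
  (forall c : 'rV[R]_n, (forall i, c ord0 i != 0 -> i \in J) ->
     c *m Bt = 0 -> c = 0) ->
  exists Z : 'M[R]_(m, n), forall i (r : 'cV[R]_n), i \in J ->
    (Bt *m (Z *m r)) i ord0 = r i ord0.
Proof.
move=> freeJ; pose E := Emx R J.
have Erow (p : nat) (M : 'M[R]_(n, p)) i j :
    (E *m M) i j = (i \in J)%:R * M i j.
  by rewrite /E /Emx mul_diag_mx !mxE.
have : (E^T <= (E *m Bt)^T)%MS.
  rewrite submxE; set C := cokermx _.
  have : C^T *m (E *m Bt) = 0.
    by apply: trmx_inj; rewrite trmx_mul trmxK trmx0 mulmx_coker.
  rewrite mulmxA => CE0; apply/eqP/trmx_inj; rewrite trmx_mul trmxK trmx0.
  apply/row_matrixP => k; rewrite row0; apply: freeJ.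
    move=> i; rewrite /E /Emx mul_mx_diag !mxE.
    by case: (i \in J) => //; rewrite mulr0 eqxx.
  by rewrite -row_mul CE0 row0.
case/submxP => D ED; exists D^T => i r iJ.
have EZ : E *m Bt *m D^T = E by rewrite -[RHS]trmxK ED trmx_mul trmxK.
have := congr1 (fun M => (M *m r) i ord0) EZ.
by rewrite /= -!mulmxA !Erow iJ !mul1r.
Qed.


Lemma le_sum_term (I : finType) (F : I -> R) (i : I) :
  (forall j, 0 <= F j) -> F i <= \sum_j F j.
Proof. by move=> F0; rewrite (bigD1 i)//= lerDl sumr_ge0. Qed.

(** Helly's theorem on the line, in a quantitative form: close to t means
    close to one another, and intervals that are closer than the smallest gap
    must meet. *)
Lemma common_point_of_near_intervals (I : finType) (lo hi : I -> R) (d t : R) :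
  (forall i, lo i <= hi i) ->
  (forall i j, hi j < lo i -> d *+ 2 <= lo i - hi j) ->
  exists x, forall i, lo i - d < t < hi i + d -> lo i <= x <= hi i.
Proof.
move=> lohi gap; pose J := [pred i | lo i - d < t < hi i + d].
case: (pickP J) => [i0 i0J|J0]; last first.
  by exists 0 => i iJ; have := J0 i; rewrite /= iJ.
case: (Order.TotalTheory.arg_maxP lo i0J) => i /= /andP[ti _] max_i.
exists (lo i) => j /[dup] /max_i -> /andP[_ tj] /=.
rewrite leNgt; apply/negP => /gap; rewrite mulr2n; lra.
Qed.

Lemma gap_threshold (I : finType) (lo hi : I -> R) :
  \forall d \near 0^'+, forall i j, hi j < lo i -> d *+ 2 <= lo i - hi j.
Proof.
have H : \forall d \near 0^'+, forall p : I * I,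
    hi p.2 < lo p.1 -> d *+ 2 <= lo p.1 - hi p.2.
  apply: filter_forall => -[i j] /=.
  have [gap|nogap] := ltP (hi j) (lo i); last by near=> d.
  near=> d => _; rewrite -[leLHS]mulr_natr -ler_pdivlMr// ltW//.
  by near: d; apply: nbhs_right_lt; rewrite divr_gt0// subr_gt0.
near=> d => i j; apply: (near H d _ (i, j)) => //.
Unshelve. all: by end_near. Qed.

(** The nodal values gam t solve exactly the equations (Bt g)_i = h_i t for the
    intervals close to t. They are bounded, since only finitely many linear
    solution operators occur, one for each set of indices. At x in the i-th
    interval, every node t near x has i among its close intervals, and hence
    (Bt gam t)_i = h_i t is near h_i x; the other nodes have a small weight. *)
Lemma vector_weierstrass (n m : nat) (Bt : 'M[R]_(n, m))
    (lo hi : 'I_n -> R) (h : 'I_n -> R -> R) (e : R) :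
  (forall i, lo i <= hi i) -> (forall i, continuous (h i)) ->
  pointwise_free (fun i => `[lo i, hi i]%classic) Bt -> 0 < e ->
  exists p : 'I_m -> {poly R}, forall i x, lo i <= x <= hi i ->
    `|\sum_j Bt i j * (p j).[x] - h i x| <= e.
Proof.
move=> lohi hc free e0.
pose L : R := 1 + \sum_i (`|lo i| + `|hi i|).
have LE i : `|lo i| <= L /\ `|hi i| <= L.
  rewrite /L (bigD1 i)//=.
  have : 0 <= \sum_(j | j != i) (`|lo j| + `|hi j|) by rewrite sumr_ge0.
  have := normr_ge0 (lo i); have := normr_ge0 (hi i); split; lra.
have L0 : 0 < L by rewrite ltr_pwDl// sumr_ge0.
have [d [d0 gap unif]] : exists d : R, [/\ 0 < d,
    forall i j, hi j < lo i -> d *+ 2 <= lo i - hi j &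
    forall i (x t : R), - L <= x <= L -> `|x - t| < d ->
      `|h i x - h i t| <= e / 2].
  suff : \forall d \near (0 : R)^'+, [/\ 0 < d,
      forall i j, hi j < lo i -> d *+ 2 <= lo i - hi j &
      forall i (x t : R), - L <= x <= L -> `|x - t| < d ->
        `|h i x - h i t| <= e / 2].
    by move=> /filter_ex[d dP]; exists d.
  have unif : \forall d \near (0 : R)^'+, forall i (x t : R),
      - L <= x <= L -> `|x - t| < d -> `|h i x - h i t| <= e / 2.
    apply: filter_forall => i.
    by apply: continuous_uniform_on_itv => //; rewrite divr_gt0.
  near=> d; split; first by near: d; exact: nbhs_right_gt.
    by near: d; exact: gap_threshold.
  by near: d; exact: unif.
have [H hH] : exists H : R, forall i (t : R), - L <= t <= L -> `|h i t| <= H.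
  have /choice[H hH] : forall i, exists H : R,
      forall t : R, - L <= t <= L -> `|h i t| <= H.
    move=> i; have [||c _ cmax] := @EVT_max R (fun t => `|h i t|) (- L) L.
    - by rewrite ge0_cp// ltW.
    - apply: continuous_subspaceT => t; apply: continuous_comp; first exact: hc.
      exact: norm_continuous.
    - by exists `|h i c| => t tL; apply: cmax; rewrite in_itv.
  exists (\sum_i `|H i|) => i t tL; apply: le_trans (hH i t tL) _.
  by rewrite (le_trans (ler_norm _))// (@le_sum_term _ (fun i => `|H i|)).
pose J (t : R) := [set i | lo i - d < t < hi i + d]%SET.
have /choice[Z hZ] : forall I : {set 'I_n}, exists Z : 'M[R]_(m, n),
    forall (t : R) i (r : 'cV[R]_n), J t = I -> i \in I ->
      (Bt *m (Z *m r)) i ord0 = r i ord0.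
  move=> I; have [[t JtI]|noI] := pselect (exists t, J t = I); last first.
    by exists 0 => t i r JtI; case: noI; exists t.
  have [x hx] := common_point_of_near_intervals t lohi gap.
  have [c cI cBt0|Z hZ] := @masked_right_inverse n m Bt I.
    apply: (free x) cBt0 => i /cI; rewrite -JtI inE => /hx.
    by rewrite /= in_itv.
  by exists Z => _ i r _; exact: hZ.
pose hv (t : R) : 'cV[R]_n := \col_i h i t.
pose gam (t : R) := Z (J t) *m hv t.
have [G hG] : exists G : R, forall i (t : R), - L <= t <= L ->
    `|(Bt *m gam t) i ord0| <= G.
  exists (\sum_(I : {set 'I_n}) \sum_i \sum_l `|(Bt *m Z I) i l| * `|H|).
  move=> i t tL.
  rewrite mulmxA mxE (le_trans (ler_norm_sum _ _ _))//.
  apply: (@le_trans _ _ (\sum_l `|(Bt *m Z (J t)) i l| * `|H|)).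
    apply: ler_sum => l _; rewrite normrM ler_wpM2l// mxE.
    by rewrite (le_trans (hH _ _ tL))// ler_norm.
  apply: le_trans (@le_sum_term _
    (fun I => \sum_i \sum_l `|(Bt *m Z I) i l| * `|H|)
    (J t) _) => [|I]; last by do 2![apply: sumr_ge0 => ? _]; rewrite mulr_ge0.
  apply: (@le_sum_term _ (fun i => \sum_l `|(Bt *m Z (J t)) i l| * `|H|)) => k.
  by rewrite sumr_ge0.
pose M : R := `|G| + `|H|; pose delta : R := d / (L *+ 2).
have L20 : 0 < L *+ 2 by rewrite mulrn_wgt0.
have delta0 : 0 < delta by rewrite divr_gt0.
have de0 : 0 < delta ^+ 2 * (e / 2).
  exact: mulr_gt0 (exprn_gt0 _ delta0) (divr_gt0 e0 _).
have M0 : 0 <= M by rewrite addr_ge0.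
have [N N_gt0 NM] : exists2 N, (0 < N)%N & M / (delta ^+ 2 * (e / 2)) <= N%:R.
  exists (Num.bound (M / (delta ^+ 2 * (e / 2)))).+1 => //.
  apply: (le_trans (ltW (archi_boundP _))); last by rewrite ler_nat.
  by rewrite divr_ge0// ltW.
have N0 : 0 < N%:R :> R by rewrite ltr0n.
pose node k : R := - L + L *+ 2 * (k%:R / N%:R).
have nodeL k : (k <= N)%N -> - L <= node k <= L.
  move=> kN; have : 0 <= (k%:R / N%:R : R) <= 1.
    by apply/andP; split; rewrite ?divr_ge0// ler_pdivrMr// mul1r ler_nat.
  move: L0; rewrite /node mulr2n; nra.
exists (fun j => bernstein N (fun k => gam (node k) j ord0)
  \Po ((L *+ 2)^-1 *: ('X + L%:P))) => i x xi.
pose u : R := (L *+ 2)^-1 * (x + L).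
have xE : x = - L + L *+ 2 * u by rewrite /u mulrA divff ?gt_eqF// mul1r; ring.
have xL : - L <= x <= L by have [] := LE i; rewrite !ler_norml; lra.
have -> : \sum_j Bt i j * (bernstein N (fun k => gam (node k) j ord0)
    \Po ((L *+ 2)^-1 *: ('X + L%:P))).[x]
  = (bernstein N (fun k => (Bt *m gam (node k)) i ord0)).[u].
  under eq_bigr do rewrite horner_comp hornerZ hornerD hornerX hornerC -/u.
  rewrite -(bernstein_sum N (fun j k => gam (node k) j ord0)).
  congr (_.[_]); congr bernstein.
  by apply/funext => k; rewrite mxE.
rewrite (splitr e); apply: le_trans.
  apply: (@bernstein_approx R N _ (h i x) u (e / 2) M delta) => //.
  - rewrite -(pmulr_rge0 _ L20) -(ler_pM2l L20 u 1).
    by move: xL xE; rewrite mulr1 mulr2n; lra.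
  - by rewrite divr_ge0// ltW.
  - move=> k kN kd; have xnode : `|x - node k| < d.
      rewrite xE /node.
      rewrite -[ltLHS](_ : `|L *+ 2 * (u - k%:R / N%:R)| = _); last first.
        by congr `|_|; ring.
      by rewrite normrM gtr0_norm// mulrC -ltr_pdivlMr// distrC.
    rewrite (hZ _ (node k))//; last first.
      by move: xnode xi; rewrite inE ltr_norml; lra.
    by rewrite mxE distrC unif.
  - move=> k kN; rewrite (le_trans (ler_normB _ _))// /M lerD//.
      by rewrite (le_trans (hG _ _ (nodeL _ kN)))// ler_norm.
    by rewrite (le_trans (hH _ _ xL))// ler_norm.
rewrite lerD2l ler_pdivrMr; last exact: mulr_gt0 N0 (exprn_gt0 _ delta0).
by rewrite mulrC -mulrA -ler_pdivrMr.
Unshelve. all: by end_near. Qed.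

End VectorWeierstrass.

(** * Approximate realization of polynomials by controls *)

Section Realization.
Variable R : realType.

Lemma expR_taylor1_bound (u : R) :
  `|u| <= 2^-1 -> `|expR u - 1 - u| <= u ^+ 2 *+ 2.
Proof.
rewrite ler_norml => /andP[ul uu].
have lo := expR_ge1Dx u; have hi := expR_ge1Dx (- u).
have E : expR u * expR (- u) = 1 by rewrite expRN divff// gt_eqF// expR_gt0.
rewrite ger0_norm; last lra.
have : expR u * (1 - u) <= 1 by rewrite -[leRHS]E ler_wpM2l ?expR_ge0//; lra.
rewrite mulr2n; nra.
Qed.

Lemma poly_lipschitz (p : {poly R}) (L : R) : exists2 C, 0 <= C &
  forall a b, `|a| <= L -> `|b| <= L -> `|p.[a] - p.[b]| <= C * `|a - b|.
Proof.
elim/poly_ind: p => [|p c [C C0 IH]].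
  by exists 0 => // a b _ _; rewrite !horner0 subrr normr0 mul0r.
exists (`|L| * C + (C * `|L| + `|p.[0]|)).
  by rewrite !addr_ge0// mulr_ge0.
move=> a b aL bL; rewrite !hornerMXaddC.
have -> : p.[a] * a + c - (p.[b] * b + c)
  = a * (p.[a] - p.[b]) + (a - b) * p.[b] by ring.
rewrite (le_trans (ler_normD _ _))// !normrM mulrDl lerD//.
  rewrite -mulrA ler_pM ?IH//.
  exact: le_trans aL (ler_norm _).
rewrite mulrC ler_wpM2r//.
have -> : p.[b] = (p.[b] - p.[0]) + p.[0] by ring.
rewrite (le_trans (ler_normD _ _))// lerD2r.
rewrite (le_trans (IH _ _ bL _))//; first by rewrite normr0 (le_trans _ bL).
by rewrite subr0 ler_wpM2l// (le_trans bL)// ler_norm.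
Qed.

Definition ramp (s : R) : R := Num.max s 0.

Lemma ramp_continuous : continuous ramp.
Proof.
move=> s.
by apply: (@continuous_max R R id (cst 0)); [exact: cvg_id|exact: cvg_cst].
Qed.

(** The chain rule at the kink of the ramp: the two one-sided derivatives
    agree because the outer function has a critical point there. *)
Lemma is_derive_comp_ramp (f df : R -> R) (tau t : R) :
  (forall s : R, is_derive s 1 f (df s)) -> f 0 = 0 -> df 0 = 0 ->
  is_derive t 1 (fun t => f (ramp (t - tau))) (df (ramp (t - tau))).
Proof.
move=> fdf f0 df0; have [tt|tt|tt] := ltgtP t tau.
- rewrite /ramp max_r ?subr_le0 ?ltW// df0.
  apply: (@near_eq_is_derive _ _ _ (cst 0)); rewrite ?oner_neq0//.
  near=> s; rewrite /= max_r ?f0// subr_le0 ltW//.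
  by near: s; exact: lt_nbhsl.
- rewrite /ramp max_l ?subr_ge0 ?ltW//.
  apply: (@near_eq_is_derive _ _ _ (fun t => f (t - tau)));
    rewrite ?oner_neq0//.
    near=> s; rewrite /= max_l// subr_ge0 ltW//.
    by near: s; exact: lt_nbhsr.
  have := @is_derive1_comp R f (shift (- tau)) t _ _ (fdf (t - tau))
    (is_derive_shift t 1 (- tau)).
  by rewrite mulr1.
rewrite tt subrr /ramp maxxx df0.
have [dv0 dval0] := fdf 0.
have slope0 : (h^-1 *: f h) @[h --> 0^'] --> (0 : R).
  case/cvg_ex: dv0 => l fl; have l0 : l = 0.
    by transitivity (df 0) => //; rewrite -dval0; apply/esym/cvg_lim.
  rewrite l0 in fl; apply: cvg_trans fl; apply: near_eq_cvg; near=> h.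
  by rewrite /= f0 subr0 addr0 [_%:A]mulr1.
have Q : (fun h => h^-1 *:
    (((fun t => f (Num.max (t - tau) 0)) \o shift tau) (h *: 1)
     - f (Num.max (tau - tau) 0))) @ 0^' --> (0 : R).
  apply/cvgrPdist_le => /= e e0.
  move/cvgrPdist_le : slope0 => /(_ _ e0); apply: filterS => h /=.
  rewrite !sub0r !normrN addrK [_%:A]mulr1 subrr maxxx f0 subr0.
  have [_|_ //] := leP h 0.
  by rewrite f0 scaler0 normr0 (ltW e0).
by apply: DeriveDef; [apply/cvg_ex; exists 0|apply: cvg_lim].
Unshelve. all: by end_near. Qed.

(** The solution of y' = x y + s with y = 0 at s = 0. *)
Definition response (x s : R) : R := (expR (x * s) - 1 - x * s) / x ^+ 2.

Lemma is_derive_response (x s : R) : x != 0 ->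
  is_derive s 1 (response x) (x * response x s + s).
Proof.
move=> x0.
have dE : is_derive s 1 (fun s => expR (x * s)) (expR (x * s) * x).
  apply: is_derive1_comp; apply: trigger_derive.
  by rewrite /GRing.scale/= mulr1.
have -> : response x =
    (fun s => (x ^- 2) *: (expR (x * s) - 1 - x *: s)) :> (R -> R).
  by apply/funext => r; rewrite /response mulrC.
apply: trigger_derive; rewrite /response /GRing.scale/=.
by field.
Qed.

Lemma is_derive_ramp_response (x tau t : R) : x != 0 ->
  is_derive t 1 (fun t => response x (ramp (t - tau)))
    (x * response x (ramp (t - tau)) + ramp (t - tau)).
Proof.
move=> x0.
apply: (@is_derive_comp_ramp _ (fun s => x * response x s + s)).
- by move=> s; exact: is_derive_response.
- by rewrite /response mulr0 expR0 !subrr mul0r.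
- by rewrite /response mulr0 expR0 !subrr mul0r mulr0 addr0.
Qed.

Lemma derivative_at_1 (N : nat) (q : {poly R}) : (size q <= N)%N ->
  q^`().[1] = \sum_(k < N) q`_k * k%:R.
Proof.
move=> qN; rewrite -[in LHS](take_poly_id qN) /take_poly poly_def.
rewrite raddf_sum horner_sum; apply: eq_bigr => k _ /=.
by rewrite derivZ derivXn hornerZ hornerMn hornerXn expr1n.
Qed.

(** Controls that are sums of ramps, with kinks at the times 1 - k/M. The one
    with weights q_k has at time 1 the response
    (q(w) - q(1) - (x/M) q'(1)) / x^2, where w = exp(x/M). With
    q(w) = (M (w - 1))^2 p (M (w - 1)) the correction terms vanish, and since
    M (w - 1) tends to x, the response tends to p(x). The error is
    O(x^2 / M) before the division by x^2, so that the estimate is uniform up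
    to x = 0. *)
Lemma scalar_realization (p : {poly R}) (L e : R) : 0 < L -> 0 < e ->
  exists (v : R -> R) (y : R -> R -> R), continuous v /\
    forall x, x != 0 ->
      [/\ y x 0 = 0,
          forall t : R, is_derive t 1 (y x) (x * y x t + v t)
        & `|x| <= L -> `|y x 1 - p.[x]| <= e].
Proof.
move=> L0 e0.
have [C C0 lipC] := poly_lipschitz ('X ^+ 2 * p) (L *+ 2).
have [M [M_gt0 Msize ML MC]] : exists M : nat,
    [/\ (0 < M)%N, ((size p).+1 < M)%N, L *+ 2 <= M%:R & C *+ 2 / e <= M%:R].
  exists (maxn (size p).+2
    (maxn (Num.bound (L *+ 2)) (Num.bound (C *+ 2 / e)))).
  split; [by rewrite !leq_max|by rewrite !leq_max leqnn| |].
    apply: (le_trans (ltW (archi_boundP _))); first by rewrite mulrn_wge0// ltW.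
    by rewrite ler_nat !leq_max leqnn orbT.
  apply: (le_trans (ltW (archi_boundP _))).
    by rewrite divr_ge0// ?mulrn_wge0// ltW.
  by rewrite ler_nat !leq_max leqnn !orbT.
have M0 : 0 < M%:R :> R by rewrite ltr0n.
(* z is M (w - 1) as a polynomial in w, and s is p at that point. *)
pose z : {poly R} := M%:R *: ('X - 1%:P).
pose s : {poly R} := p \Po z.
pose q : {poly R} := z ^+ 2 * s.
have qE w : q.[w] = ('X ^+ 2 * p).[M%:R * (w - 1)].
  rewrite /q /s /z.
  by rewrite !(hornerM, horner_comp, hornerZ, hornerXsubC, horner_exp, hornerX).
(* The degree of q is at most M, so that all the kinks occur in [0, 1]. *)
have qsize : (size q <= M.+1)%N.
  have zsize : (size z <= 2)%N.
    by rewrite (leq_trans (size_scale_leq _ _))// size_XsubC.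
  have ssize : (size s <= (size p).-1.+1)%N.
    rewrite (leq_trans (size_comp_poly_leq _ _))// ltnS.
    rewrite -[leqRHS]muln1 leq_mul2l.
    by case: (size z) zsize => [|[|[]]]; rewrite ?orbT.
  have z2size : (size (z ^+ 2)%R <= 3)%N.
    rewrite (leq_trans (size_polyMleq _ _))//.
    by case: (size z) zsize => [|[|[]]].
  rewrite (leq_trans (size_polyMleq _ _))//.
  have := leq_add z2size ssize; case: (size p) Msize => [|k] /=; lia.
have q1 : q.[1] = 0 by rewrite qE subrr mulr0 hornerM hornerXn expr0n mul0r.
have dq1 : q^`().[1] = 0.
  have z1 : z.[1] = 0 by rewrite hornerZ hornerXsubC subrr mulr0.
  rewrite /q derivM deriv_exp /= !(hornerD, hornerM, hornerMn, horner_exp) z1.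
  by rewrite ?expr1 ?expr0n !(mul0r, mulr0, mul0rn, addr0).
pose tau k : R := 1 - k%:R / M%:R.
exists (fun t => \sum_(k < M.+1) q`_k * ramp (t - tau k)).
exists (fun x t => \sum_(k < M.+1) q`_k * response x (ramp (t - tau k))).
split.
  apply: continuous_big => [|k _ t]; first exact: add_continuous.
   apply: cvgM; first exact: cvg_cst.
  apply: (@continuous_comp _ _ _ (fun t => t - tau k) ramp t);
    last exact: ramp_continuous.
  by apply: cvgB; [exact: cvg_id|exact: cvg_cst].
move=> x x0; split.
- rewrite big1// => k _; rewrite /ramp max_r; last first.
    by rewrite sub0r oppr_le0 subr_ge0 ler_pdivrMr// mul1r ler_nat -ltnS.
  by rewrite /response mulr0 expR0 !subrr mul0r mulr0.
- move=> t; rewrite mulr_sumr -big_split /=.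
  have -> : (fun t => \sum_(k < M.+1) q`_k * response x (ramp (t - tau k))) =
      \sum_(k < M.+1) (fun t => q`_k *: response x (ramp (t - tau k)))
      :> (R -> R).
    by apply/funext => r; rewrite fct_sumE.
  apply: is_derive_sum => k; have := is_derive_ramp_response (tau k) t x0.
  move=> dk; apply: trigger_derive; rewrite /GRing.scale/=; ring.
move=> xL; pose w := expR (x / M%:R).
have yE : \sum_(k < M.+1) q`_k * response x (ramp (1 - tau k)) = q.[w] / x ^+ 2.
  have wk k : expR (x * (k%:R / M%:R)) = w ^+ k.
    by rewrite /w -expRM_natl mulr_natl; congr expR; rewrite -mulr_natl; ring.
  have -> : q.[w] = q.[w] - q.[1] - x / M%:R * q^`().[1].
    by rewrite q1 dq1 mulr0 !subr0.
  rewrite (derivative_at_1 qsize) !(horner_coef_wide _ qsize).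
  rewrite mulr_sumr -!sumrB mulr_suml; apply: eq_bigr => k _.
  rewrite /tau subKr /ramp max_l ?divr_ge0// /response wk expr1n; field.
  by rewrite x0 gt_eqF.
rewrite yE qE; set a := M%:R * (w - 1).
have xM : `|x / M%:R| <= 2^-1.
  rewrite normrM normfV [`|M%:R|]gtr0_norm// ler_pdivrMr//.
  by rewrite mulrC ler_pdivlMr//; move: ML xL; rewrite mulr2n; lra.
have ax : `|a - x| <= x ^+ 2 *+ 2 / M%:R.
  have -> : a - x = M%:R * (w - 1 - x / M%:R).
    by rewrite /a; field; rewrite gt_eqF.
  rewrite normrM gtr0_norm// mulrC -ler_pdivlMr//.
  rewrite (le_trans (expR_taylor1_bound xM))// le_eqVlt; apply/orP; left.
  by apply/eqP; rewrite !mulr2n; field; rewrite gt_eqF.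
have aL : `|a| <= L *+ 2.
  have -> : a = (a - x) + x by ring.
  rewrite (le_trans (ler_normD _ _))// mulr2n lerD// (le_trans ax)//.
  rewrite ler_pdivrMr// -[x ^+ 2]real_normK ?num_real//.
  move: ML (normr_ge0 x); rewrite !mulr2n; nra.
have x2 : 0 < x ^+ 2 by rewrite exprn_even_gt0.
have -> : ('X ^+ 2 * p).[a] / x ^+ 2 - p.[x] =
    (('X ^+ 2 * p).[a] - ('X ^+ 2 * p).[x]) / x ^+ 2.
  by rewrite [in X in _ = (_ - X) / _]hornerM hornerXn; field.
rewrite normrM normfV [`|x ^+ 2|]gtr0_norm// ler_pdivrMr//.
rewrite (le_trans (lipC _ _ aL _))//.
  by rewrite (le_trans xL)// mulr2n; lra.
rewrite (le_trans (ler_wpM2l C0 ax))// mulrA ler_pdivrMr//.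
move: MC; rewrite ler_pdivrMr// => MC.
by have := ler_wpM2r (ltW x2) MC; rewrite !mulr2n; lra.
Qed.

End Realization.

(** * Calculus for vector-valued functions *)

Section MatrixCalculus.
Variable R : realType.

Lemma continuous_at_mx (T : topologicalType) (m n : nat) (F : T -> 'M[R]_(m, n))
    (t : T) :
  (forall i j, {for t, continuous (fun s => F s i j)}) -> {for t, continuous F}.
Proof.
move=> Fij; apply/cvgrPdist_le => /= e e0; near=> s.
rewrite /Num.Def.normr/= mx_normrE (bigmax_le _ (ltW e0))//= => i _.
rewrite !mxE; move: i; near: s; apply: filter_forall => /= i.
by have /cvgrPdist_le := Fij i.1 i.2; exact.
Unshelve. all: by end_near. Qed.

Lemma is_derive_mx (m n : nat) (F : R -> 'M[R]_(m, n)) (t : R)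
    (dF : 'M[R]_(m, n)) :
  (forall i j, is_derive t 1 (fun s => F s i j) (dF i j)) ->
  is_derive t 1 F dF.
Proof.
move=> dFij; have dFt : derivable F t 1.
  by apply/derivable_mxP => i j; have [] := dFij i j.
apply: DeriveDef => //; rewrite derive_mx//.
by apply/matrixP => i j; rewrite mxE; have [] := dFij i j.
Qed.

Lemma is_derive_coord (m n : nat) (F : R -> 'M[R]_(m, n)) (t : R)
    (dF : 'M[R]_(m, n)) i j :
  is_derive t 1 F dF -> is_derive t 1 (fun s => F s i j) (dF i j).
Proof.
move=> [dFt <-]; apply: DeriveDef; first by move/derivable_mxP : dFt.
by rewrite derive_mx// mxE.
Qed.

Lemma continuous_at_mulmx_coord (T : topologicalType) (m n : nat)
    (M : 'M[R]_(m, n)) (F : T -> 'cV[R]_n) (t : T) i :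
  {for t, continuous F} -> {for t, continuous (fun s => (M *m F s) i ord0)}.
Proof.
move=> Ft.
suff : (M *m F s) i ord0 @[s --> t] --> (M *m F t) i ord0 by [].
rewrite mxE; under eq_cvg do rewrite mxE.
apply: cvg_big => [|k _]; first exact: add_continuous.
apply: cvgM; first exact: cvg_cst.
apply: (@continuous_comp _ _ _ F (fun M : 'cV[R]_n => M k ord0)) => //.
exact: coord_continuous.
Qed.

Lemma is_derive_mulmx_coord (m n : nat) (M : 'M[R]_(m, n))
    (F : R -> 'cV[R]_n) (t : R) (dF : 'cV[R]_n) i :
  (forall k, is_derive t 1 (fun s => F s k ord0) (dF k ord0)) ->
  is_derive t 1 (fun s => (M *m F s) i ord0) ((M *m dF) i ord0).
Proof.
move=> Ft.
have -> : (fun s => (M *m F s) i ord0) =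
    \sum_k (fun s => M i k *: F s k ord0) :> (R -> R).
  by apply/funext => s; rewrite fct_sumE mxE.
by rewrite mxE; apply: is_derive_sum => k; exact: is_deriveZ.
Qed.

Definition clamp (a b x : R) : R := Num.max a (Num.min x b).

Lemma clamp_id (a b x : R) : a <= x <= b -> clamp a b x = x.
Proof. by move=> /andP[ax xb]; rewrite /clamp min_l// max_r. Qed.

Lemma clamp_itv (a b x : R) : a <= b -> a <= clamp a b x <= b.
Proof.
by move=> ab; rewrite /clamp le_max lexx /= ge_max ab ge_min lexx orbT.
Qed.

(** Data given on K only become continuous on the whole line, so that the
    functions x |-> h (x / lam_i) need no relative continuity. *)
Lemma continuous_clamp (V : topologicalType) (a b : R) (f : R -> V) :
  a <= b -> {within `[a, b], continuous f} -> continuous (f \o clamp a b).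
Proof.
move=> ab /subspace_continuousP fc t.
have clc : clamp a b s @[s --> t] --> clamp a b t.
  apply: (@continuous_max R R (cst a) (fun x => Num.min x b)).
    exact: cvg_cst.
  by apply: (@continuous_min R R id (cst b)); [exact: cvg_id|exact: cvg_cst].
have clK s : `[a, b]%classic (clamp a b s) by rewrite /= in_itv clamp_itv.
have clw : clamp a b s @[s --> t] -->
    within `[a, b]%classic (nbhs (clamp a b t)).
  move=> U /clc UW; apply: (@filterS _ (nbhs t) _ _ _ _ UW) => s H.
  exact: H (clK s).
exact: cvg_comp clw (fc _ (clK t)).
Qed.

Lemma enorm_le_sum (n : nat) (v : 'cV[R]_n) :
  enorm v <= \sum_i `|v i ord0|.
Proof.
rewrite /enorm -[leRHS]ger0_norm ?sumr_ge0// -sqrtr_sqr ler_wsqrtr//.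
rewrite expr2 mulr_suml ler_sum// => i _.
rewrite -[v i ord0 ^+ 2]real_normK ?num_real// expr2 ler_wpM2l//.
by rewrite (bigD1 i)//= lerDl sumr_ge0.
Qed.

Lemma coord_le_enorm (n : nat) (v : 'cV[R]_n) i : `|v i ord0| <= enorm v.
Proof.
rewrite /enorm -sqrtr_sqr ler_wsqrtr// (bigD1 i)//= lerDl sumr_ge0// => j _.
exact: sqr_ge0.
Qed.

End MatrixCalculus.

(** * Sufficiency of pointwise independence *)

Section Sufficiency.
Variable R : realType.

Lemma spectrum_itv (n : nat) (b1 b2 : R) (lam : 'rV[R]_n) (i : 'I_n) (x : R) :
  b1 <= b2 -> lam ord0 i != 0 ->
  spectrum `[b1, b2]%classic lam i x <->
  Num.min (lam ord0 i * b1) (lam ord0 i * b2) <= x <=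
  Num.max (lam ord0 i * b1) (lam ord0 i * b2).
Proof.
move=> b12; set l := lam ord0 i => l0; have lsgn : 0 < l \/ l < 0.
  by move: l0; rewrite neq_lt => /orP[]; [right|left].
split.
  move=> [b /=]; rewrite in_itv /= => /andP[b1b bb2] <-; rewrite -/l.
  rewrite ge_min le_max; case: lsgn => ls.
    by rewrite !ler_pM2l// b1b bb2 orbT.
  by rewrite !ler_nM2l// b1b bb2 orbT.
move=> xl; exists (x / l); last by rewrite -/l mulrC divfK.
case: lsgn => ls; rewrite /= in_itv /=.
  move: xl; rewrite min_l ?ler_pM2l// max_r ?ler_pM2l//.
  by rewrite ler_pdivlMr// ler_pdivrMr// ![_ * l]mulrC.
move: xl; rewrite min_r ?ler_nM2l// max_l ?ler_nM2l//.
by rewrite ler_ndivlMr// ler_ndivrMr// ![_ * l]mulrC andbC.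
Qed.

Lemma continuous_piecewise (m : nat) (T : R) (U : R -> 'cV[R]_m) :
  0 < T -> continuous U -> piecewise_continuous T U.
Proof.
move=> T0 Uc; exists [:: T]; first by split; rewrite /= ?T0.
case=> // _ a b; split; first by move=> x _; exact: Uc.
  by apply/cvg_ex; exists (U a); apply: cvg_at_right_filter; exact: Uc.
by apply/cvg_ex; exists (U b); apply: cvg_at_left_filter; exact: Uc.
Qed.

(** After removal of the free motion exp(x) y0 at time 1, the target in the
    i-th coordinate is h i, a function of x = lam_i b. It is approximated by
    (Bt p)_i, and each polynomial p j by a response to one control. *)
Lemma pointwise_free_controllable (n m : nat) (b1 b2 : R) (A P : 'M[R]_n)
    (B Bt : 'M[R]_(n, m)) (G : 'M[R]_m) (lam : 'rV[R]_n) :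
  b1 <= b2 -> (forall b, b1 <= b <= b2 -> b != 0) ->
  (forall i, lam ord0 i != 0) -> P \in unitmx -> G \in unitmx ->
  A = P *m diag_mx lam *m invmx P -> B = P *m Bt *m G ->
  pointwise_free (spectrum `[b1, b2]%classic lam) Bt ->
  uniformly_ensemble_controllable `[b1, b2]%classic A B.
Proof.
move=> b12 Kn0 lam0 unitP unitG diagA factB free X0 XF X0c XFc eps eps0.
pose y0 i (b : R) : R := (invmx P *m X0 (clamp b1 b2 b)) i ord0.
pose yF i (b : R) : R := (invmx P *m XF (clamp b1 b2 b)) i ord0.
have y0c i : continuous (y0 i).
  move=> b; apply: continuous_at_mulmx_coord.
  exact: (continuous_clamp b12 X0c).
have yFc i : continuous (yF i).
  move=> b; apply: continuous_at_mulmx_coord.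
  exact: (continuous_clamp b12 XFc).
pose l i : R := lam ord0 i.
pose h i (x : R) : R := yF i (x / l i) - expR x * y0 i (x / l i).
have hc i : continuous (h i).
  move=> x; have divc : {for x, continuous (fun x : R => x / l i)}.
    by apply: cvgM; [exact: cvg_id|exact: cvg_cst].
  apply: cvgB; first by apply: (continuous_comp divc); exact: yFc.
  apply: cvgM; first exact: continuous_expR.
  by apply: (continuous_comp divc); exact: y0c.
pose lo i : R := Num.min (l i * b1) (l i * b2).
pose hi i : R := Num.max (l i * b1) (l i * b2).
have specE i (x : R) : spectrum `[b1, b2]%classic lam i x <-> lo i <= x <= hi i.
  exact: spectrum_itv.
(* P multiplies the entrywise errors by at most S in Euclidean norm. *)
pose S : R := \sum_i \sum_k `|P i k|.
have S0 : 0 <= S by apply: sumr_ge0 => i _; rewrite sumr_ge0.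
pose eta : R := eps / 2 / (1 + S).
have S10 : 0 < 1 + S by rewrite ltr_pwDl.
have eta0 : 0 < eta by rewrite !divr_gt0.
have [p hp] : exists p : 'I_m -> {poly R},
    forall i (x : R), lo i <= x <= hi i ->
    `|\sum_j Bt i j * (p j).[x] - h i x| <= eta / 2.
  apply: vector_weierstrass => //; last by rewrite divr_gt0.
    by move=> i; rewrite /lo /hi ge_min !le_max lexx.
  move=> x c cx; apply: (free x) => i /cx.
  by rewrite /= in_itv => /specE.
pose L : R := 1 + \sum_i (`|lo i| + `|hi i|).
have L0 : 0 < L by rewrite ltr_pwDl// sumr_ge0.
have xL i (x : R) : lo i <= x <= hi i -> `|x| <= L.
  move=> xi; rewrite /L (bigD1 i)//=.
  have : 0 <= \sum_(j | j != i) (`|lo j| + `|hi j|) by rewrite sumr_ge0.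
  have := ler_norm (hi i); have := ler_norm (- lo i); rewrite normrN.
  have := normr_ge0 (lo i); have := normr_ge0 (hi i).
  by rewrite ler_norml; lra.
pose Sb : R := \sum_i \sum_j `|Bt i j|.
have Sb0 : 0 <= Sb by apply: sumr_ge0 => i _; rewrite sumr_ge0.
have Sb10 : 0 < 1 + Sb by rewrite ltr_pwDl.
have e1_gt0 : 0 < eta / 2 / (1 + Sb) by rewrite !divr_gt0.
have /choice[v /choice[y vy]] := fun j => scalar_realization (p j) L0 e1_gt0.
have vc j : continuous (v j) by have [] := vy j.
pose V (t : R) : 'cV[R]_m := \col_j v j t.
pose Y (t b : R) : 'cV[R]_n := \col_i
  (expR (l i * b * t) * y0 i b + \sum_j Bt i j * y j (l i * b) t).
have lb0 i (b : R) : b1 <= b <= b2 -> l i * b != 0.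
  by move=> bK; rewrite mulf_neq0// Kn0.
have Y0E (b : R) : b1 <= b <= b2 -> P *m Y 0 b = X0 b.
  move=> bK; rewrite -[RHS](mulKVmx unitP); congr (_ *m _).
  apply/colP => i; rewrite mxE mulr0 expR0 mul1r big1 ?addr0.
    by rewrite /y0 clamp_id.
  move=> j _; have [_ /(_ _ (lb0 i _ bK))[-> _ _]] := vy j.
  by rewrite mulr0.
have dY (b t : R) : b1 <= b <= b2 -> forall k,
    is_derive t 1 (fun s => Y s b k ord0)
      ((b *: (diag_mx lam *m Y t b) + Bt *m V t) k ord0).
  move=> bK k.
  have -> : (fun s => Y s b k ord0) = (fun s => y0 k b *: expR (l k * b * s)) +
      \sum_j (fun s => Bt k j *: y j (l k * b) s) :> (R -> R).
    by apply/funext => s; rewrite /= fctE fct_sumE mxE mulrC.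
  have dE : is_derive t 1 (fun s => expR (l k * b * s))
      (expR (l k * b * t) * (l k * b)).
    apply: is_derive1_comp; apply: trigger_derive.
    by rewrite /GRing.scale/= mulr1.
  have dS : is_derive t 1 (\sum_j (fun s => Bt k j *: y j (l k * b) s))
      (\sum_j (Bt k j *: (l k * b * y j (l k * b) t + v j t))).
    apply: is_derive_sum => j.
    by have [_ /(_ _ (lb0 k _ bK))[_ /(_ t)]] := vy j => ? _; exact: is_deriveZ.
  apply: trigger_derive.
  rewrite mul_diag_mx !mxE /GRing.scale/= -/(l k) !mulrDr -!addrA.
  congr (_ + _); first by ring.
  rewrite !mulr_sumr -big_split /=; apply: eq_bigr => j _.
  by rewrite !mxE; ring.
have YT i (b : R) : b1 <= b <= b2 -> `|Y 1 b i ord0 - yF i b| <= eta.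
  move=> bK; pose x : R := l i * b.
  have xi : lo i <= x <= hi i by apply/specE; exists b.
  have hx : h i x = yF i b - expR x * y0 i b.
    by rewrite /h /x [l i * b]mulrC mulfK// [l i * b]mulrC.
  have -> : Y 1 b i ord0 - yF i b =
      \sum_j Bt i j * (y j x 1 - (p j).[x]) +
      (\sum_j Bt i j * (p j).[x] - h i x).
    rewrite hx mxE mulr1 -/x; under [in RHS]eq_bigr do rewrite mulrBr.
    by rewrite sumrB; ring.
  rewrite (le_trans (ler_normD _ _))// (splitr eta) lerD ?hp//.
  rewrite (le_trans (ler_norm_sum _ _ _))//.
  apply: (@le_trans _ _ (Sb * (eta / 2 / (1 + Sb)))); last first.
    by rewrite mulrA ler_pdivrMr// mulrC ler_wpM2l ?lerDr// ltW// divr_gt0.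
  apply: (@le_trans _ _ ((\sum_j `|Bt i j|) * (eta / 2 / (1 + Sb))));
    last first.
    apply: ler_wpM2r; first exact: ltW.
    apply: (@le_sum_term _ _ (fun i => \sum_j `|Bt i j|)) => k.
    by rewrite sumr_ge0.
  rewrite mulr_suml; apply: ler_sum => j _; rewrite normrM ler_wpM2l//.
  by have [_ /(_ _ (lb0 i _ bK))[_ _]] := vy j; apply; exact: xL xi.
exists 1; split=> //; exists (fun t => invmx G *m V t); split.
  apply: continuous_piecewise => // t.
  apply: continuous_at_mx => i j; rewrite (ord1 j).
  apply: continuous_at_mulmx_coord; apply: continuous_at_mx => k k'.
  suff : V s k k' @[s --> t] --> V t k k' by [].
  by rewrite mxE; under eq_cvg do rewrite mxE; exact: vc.
exists (fun t b => P *m Y t b); split.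
  move=> b; rewrite /= in_itv /= => bK.
  have dX (t : R) : is_derive t 1 (fun s => P *m Y s b)
      (b *: (A *m (P *m Y t b)) + B *m (invmx G *m V t)).
    apply: is_derive_mx => i j; rewrite (ord1 j).
    have -> : b *: (A *m (P *m Y t b)) + B *m (invmx G *m V t) =
        P *m (b *: (diag_mx lam *m Y t b) + Bt *m V t).
      rewrite diagA factB -!mulmxA mulKVmx// (mulKmx unitP) mulmxDr.
      by rewrite -!scalemxAr.
    apply: is_derive_mulmx_coord; exact: dY.
  split; [|exact: Y0E|by move=> t _ _; exact: dX].
  apply: continuous_subspaceT => t.
  have [dXt _] := dX t; apply: differentiable_continuous.
  exact/derivable1_diffP.
apply: (@le_lt_trans _ _ (eps / 2)%:E); last first.
  by rewrite lte_fin ltr_pdivrMr// mulr_natr mulr2n ltrDl.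
apply: ge_ereal_sup => _ [b bK <-]; rewrite lee_fin.
move: bK; rewrite /= in_itv /= => bK.
have -> : P *m Y 1 b - XF b = P *m (Y 1 b - \col_i yF i b).
  rewrite mulmxBr; congr (_ - _); rewrite -[LHS](mulKVmx unitP).
  by congr (_ *m _); apply/colP => i; rewrite [RHS]mxE /yF clamp_id.
rewrite (le_trans (enorm_le_sum _))//.
apply: (@le_trans _ _ (S * eta)); last first.
  by rewrite mulrA ler_pdivrMr// mulrC ler_wpM2l ?lerDr// ltW// divr_gt0.
rewrite mulr_suml; apply: ler_sum => i _; rewrite mxE mulr_suml.
rewrite (le_trans (ler_norm_sum _ _ _))//; apply: ler_sum => k _.
by rewrite normrM ler_wpM2l// !mxE; have := YT k b bK; rewrite mxE.
Qed.

End Sufficiency.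

(** * Necessity of pointwise independence *)

Section Necessity.
Variable R : realType.

Lemma linear_ode_zero (x a b : R) (z : R -> R) : a < b ->
  {within `[a, b], continuous z} ->
  (forall t, t \in `]a, b[ -> is_derive t 1 z (x * z t)) ->
  z a = 0 -> z b = 0.
Proof.
move=> ab zc dz za.
(* The integrating factor turns z into a constant. *)
pose w t : R := expR (- x * t) * z t.
have dw t : t \in `]a, b[ -> is_derive t 1 w 0.
  move=> tab; have dzt := dz t tab.
  have dE : is_derive t 1 (fun t => expR (- x * t)) (expR (- x * t) * - x).
    apply: is_derive1_comp; apply: trigger_derive.
    by rewrite /GRing.scale/= mulr1.
  apply: trigger_derive; rewrite /GRing.scale/=; ring.
have wc : {within `[a, b], continuous w}.
  have Ec : {within `[a, b], continuous (fun t => expR (- x * t))}.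
    apply: continuous_subspaceT => t.
    apply: continuous_comp; last exact: continuous_expR.
    by apply: cvgM; [exact: cvg_cst|exact: cvg_id].
  by move=> t; apply: cvgM; [exact: Ec|exact: zc].
have [c _] := MVT ab dw wc; rewrite mul0r {2}/w za mulr0 subr0 => /eqP.
by rewrite mulf_eq0 gt_eqF ?expR_gt0//= => /eqP.
Qed.

(** The equation is only known at the times with property C, here those at
    which the control is continuous; continuity of z carries its vanishing
    across the breakpoints. *)
Lemma linear_ode_zero_partition (x T : R) (z : R -> R) (C : R -> Prop) :
  {within `[0, T], continuous z} ->
  (forall t : R, 0 < t < T -> C t -> is_derive t 1 z (x * z t)) ->
  forall (s : seq R) (a : R), 0 <= a -> path <%R a s -> last a s <= T ->
    (forall k, (k < size s)%N ->
       forall t, t \in `]nth 0 (a :: s) k, nth 0 s k[ -> C t) ->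
    z a = 0 -> z (last a s) = 0.
Proof.
move=> zc dz; elim=> [//|b s IH] a a0 /= /andP[ab bs] sT Cs za.
have bT : b <= T.
  rewrite (le_trans _ sT)//; have := mem_last b s; rewrite inE.
  move=> /orP[/eqP->//|]; move/(order_path_min lt_trans) : bs => /allP bs.
  by move=> /bs/ltW.
apply: IH => //; first by rewrite (le_trans a0)// ltW.
  by move=> k ks t tk; apply: (Cs k.+1).
apply: (linear_ode_zero ab _ _ za).
  apply: continuous_subspaceW zc => t /=; rewrite !in_itv /= => /andP[at1 tb].
  by rewrite (le_trans a0)//= (le_trans tb).
move=> t tab; apply: dz; last exact: (Cs 0%N).
move: tab; rewrite in_itv /= => /andP[at1 tb].
by rewrite (le_lt_trans a0)//= (lt_le_trans tb).
Qed.

(** A dependence c at x yields a combination z of states, taken at the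
    parameters b i with lam_i (b i) = x, on which no control acts and which
    evolves by z' = x z. *)
Lemma controllable_pointwise_free (n m : nat) (K : set R) (A P : 'M[R]_n)
    (B Bt : 'M[R]_(n, m)) (G : 'M[R]_m) (lam : 'rV[R]_n) :
  P \in unitmx ->
  A = P *m diag_mx lam *m invmx P -> B = P *m Bt *m G ->
  uniformly_ensemble_controllable K A B ->
  pointwise_free (spectrum K lam) Bt.
Proof.
move=> unitP diagA factB ctrl x c supp cBt0.
have [->//|c0] := eqVneq c 0; exfalso.
have /choice[b hb] : forall i, exists b : R,
    c ord0 i != 0 -> K b /\ lam ord0 i * b = x.
  move=> i; have [_|/supp[b Kb <-]] := eqVneq (c ord0 i) 0; last by exists b.
  by exists 0.
pose s : R := \sum_i c ord0 i ^+ 2.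
have s0 : 0 < s.
  rewrite lt_neqAle eq_sym sumr_ge0 ?andbT => [|i _]; last exact: sqr_ge0.
  apply: contra c0; rewrite psumr_eq0 => [/allP sz|i _]; last exact: sqr_ge0.
  apply/eqP/rowP => i; rewrite mxE; apply/eqP.
  by have := sz i (mem_index_enum i); rewrite sqrf_eq0.
pose W : R := \sum_i \sum_k `|c ord0 i| * `|invmx P i k|.
have W0 : 0 <= W.
  by do 2![apply: sumr_ge0 => ? _]; rewrite mulr_ge0.
have W10 : 0 < 1 + W by rewrite ltr_pwDl.
have cst_cont (v : 'cV[R]_n) : {within K, continuous (fun _ : R => v)}.
  by move=> t; exact: cvg_cst.
(* The target P c^T has z = s > 0, while z starts and remains at 0; the
   tolerance is below the distance that this forces. *)
have [T [T0 [U [[p [p_path /eqP p_last] Up] [X [solX supX]]]]]] :=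
  ctrl _ _ (cst_cont 0) (cst_cont (P *m c^T)) (s / (1 + W)) (divr_gt0 s0 W10).
pose Z i (t : R) : R := (invmx P *m X t (b i)) i ord0.
pose z (t : R) : R := \sum_i c ord0 i * Z i t.
have z0 : z 0 = 0.
  rewrite /z big1// => i _; have [->|/hb[Kb _]] := eqVneq (c ord0 i) 0.
    by rewrite mul0r.
  by have [_ X0 _] := solX _ Kb; rewrite /Z X0 mulmx0 mxE mulr0.
have zc : {within `[0, T], continuous z}.
  move=> t; apply: cvg_big => [|i _]; first exact: add_continuous.
  have [->|/hb[Kb _]] := eqVneq (c ord0 i) 0.
    by rewrite mul0r; under eq_cvg do rewrite mul0r; exact: cvg_cst.
  apply: cvgM; first exact: cvg_cst.
  have [Xc _ _] := solX _ Kb.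
  exact: (@continuous_at_mulmx_coord _ (subspace `[0, T]%classic) _ _ (invmx P)
    (fun t => X t (b i)) t i (Xc t)).
have dz t : 0 < t < T -> {for t, continuous U} -> is_derive t 1 z (x * z t).
  move=> tT Ut; pose u := Bt *m (G *m U t).
  have -> : x * z t = \sum_i c ord0 i * (x * Z i t + u i ord0).
    under eq_bigr do rewrite mulrDr.
    rewrite big_split /= mulr_sumr.
    have -> : \sum_i c ord0 i * u i ord0 = 0.
      have := congr1 (fun M : 'rV[R]_m => (M *m (G *m U t)) ord0 ord0) cBt0.
      by rewrite /= -mulmxA mul0mx [X in _ = X]mxE mxE.
    by rewrite addr0; apply: eq_bigr => i _; ring.
  have -> : z = \sum_i (fun t => c ord0 i *: Z i t) :> (R -> R).
    by apply/funext => r; rewrite fct_sumE.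
  apply: is_derive_sum => i; have [->|/hb[Kb lbx]] := eqVneq (c ord0 i) 0.
    rewrite mul0r; have -> : (fun t => 0 *: Z i t) = cst 0 :> (R -> R).
      by apply/funext => r; rewrite scale0r.
    exact: is_derive_cst.
  have [_ _ /(_ t tT Ut) dX] := solX _ Kb.
  apply: is_deriveZ.
  have -> : x * Z i t + u i ord0 =
      (invmx P *m (b i *: (A *m X t (b i)) + B *m U t)) i ord0.
    rewrite diagA factB mulmxDr -scalemxAr -!mulmxA !(mulKmx unitP).
    have addE (v w : 'cV[R]_n) : (v + w) i ord0 = v i ord0 + w i ord0.
      by rewrite mxE.
    have diagE (v : 'cV[R]_n) :
        (b i *: (diag_mx lam *m v)) i ord0 = x * v i ord0.
      by rewrite mul_diag_mx !mxE mulrA [b i * _]mulrC lbx.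
    by rewrite addE diagE.
  by apply: is_derive_mulmx_coord => k; exact: is_derive_coord.
have zT : z T = 0.
  rewrite -p_last; apply: (linear_ode_zero_partition zc dz) => //.
    by rewrite p_last.
  by move=> k kp t tk; have [Uk _ _] := Up k kp; exact: Uk.
have : s <= W * (s / (1 + W)).
  have sE : `|\sum_i c ord0 i * (Z i T - c ord0 i)| = s.
    under eq_bigr do rewrite mulrBr.
    rewrite sumrB -/(z T) zT sub0r normrN.
    have -> : \sum_i c ord0 i * c ord0 i = s by [].
    by rewrite gtr0_norm.
  rewrite -[leLHS]sE.
  rewrite (le_trans (ler_norm_sum _ _ _))// mulr_suml; apply: ler_sum => i _.
  have [->|ci] := eqVneq (c ord0 i) 0.
    by rewrite mul0r normr0 big1 ?mul0r// => k _; rewrite mul0r.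
  have [Kb _] := hb i ci.
  have errb : enorm (X T (b i) - P *m c^T) <= s / (1 + W).
    rewrite -lee_fin; apply: le_trans (ltW supX).
    by apply: ereal_sup_ubound; exists (b i).
  have -> : Z i T - c ord0 i = (invmx P *m (X T (b i) - P *m c^T)) i ord0.
    by rewrite mulmxBr (mulKmx unitP) [RHS]mxE; congr (_ + _); rewrite !mxE.
  rewrite normrM -mulr_sumr -mulrA ler_wpM2l// mxE.
  rewrite (le_trans (ler_norm_sum _ _ _))// mulr_suml; apply: ler_sum => k _.
  by rewrite normrM ler_wpM2l// (le_trans (coord_le_enorm _ k)).
rewrite mulrA ler_pdivlMr// [W * s]mulrC ler_pM2l//; lra.
Qed.

End Necessity.

(** * Pointwise independence as rank conditions *)

Section RankCondition.
Variable R : realType.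

Lemma chi_overlap_set (n : nat) (K : set R) (lam : 'rV[R]_n) (I : {set 'I_n})
    (x : R) :
  overlap_set K lam I x -> chi K lam (overlap_set K lam I) = I.
Proof.
move=> Ix; apply/setP => j; rewrite inE; apply/asboolP/idP => [sub|jI y Iy].
  exact/(Ix j)/sub.
exact/(Iy j).
Qed.

Lemma mul_Emx_id (n : nat) (I : {set 'I_n}) (c : 'rV[R]_n) :
  (forall i, c ord0 i != 0 -> i \in I) -> c *m Emx R I = c.
Proof.
move=> cI; apply/rowP => i; rewrite /Emx mul_mx_diag !mxE.
have [->|/cI ->] := eqVneq (c ord0 i) 0; first by rewrite mul0r.
by rewrite mulr1.
Qed.

Lemma mul_delete_zero_rows (n m : nat) (M : 'M[R]_(n, m)) (c : 'rV[R]_n) :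
  (\row_k c ord0 (enum_val k)) *m delete_zero_rows M = c *m M.
Proof.
apply/rowP => j; rewrite !mxE [RHS](bigID (fun i => i \in nonzero_rows M)) /=.
rewrite [X in _ + X]big1 ?addr0 => [|i]; last first.
  rewrite inE negbK => /eqP/rowP/(_ j); rewrite !mxE => ->.
  by rewrite mulr0.
by rewrite [RHS]big_enum_val /=; apply: eq_bigr => k _; rewrite !mxE.
Qed.

Lemma row_free_delete_zero_rows (n m : nat) (M : 'M[R]_(n, m)) :
  (forall c : 'rV[R]_n, (forall i, c ord0 i != 0 -> i \in nonzero_rows M) ->
     c *m M = 0 -> c = 0) ->
  row_free (delete_zero_rows M).
Proof.
move=> free; apply: inj_row_free => v vM0.
(* D turns coefficients of the kept rows into coefficients of all rows. *)
pose D := rowsub (fun k => enum_val k) 1%:M : 'M[R]_(#|nonzero_rows M|, n).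
have vDE k : (v *m D) ord0 (enum_val k) = v ord0 k.
  rewrite mxE (bigD1 k)//= !mxE eqxx mulr1 big1 ?addr0// => l lk.
  by rewrite !mxE (inj_eq enum_val_inj) (negbTE lk) mulr0.
have vD0 : v *m D = 0.
  apply: free; last by rewrite -mulmxA mul_rowsub_mx mul1mx.
  move=> i; apply: contraR => iM; rewrite mxE big1// => k _; rewrite !mxE.
  have [ki|] := eqVneq (enum_val k) i; last by rewrite mulr0.
  by rewrite -ki enum_valP in iM.
by apply/rowP => k; rewrite -vDE vD0 !mxE.
Qed.

Lemma identity_rows_free (n m : nat) (hmn : (m < n)%N) (Bt : 'M[R]_(n, m))
    (c : 'rV[R]_n) : top_rows hmn Bt = 1%:M ->
  (forall i, c ord0 i != 0 -> (i < m)%N) -> c *m Bt = 0 -> c = 0.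
Proof.
move=> top1 cm cBt0; apply/rowP => i; rewrite mxE.
have [//|/[dup] ci /cm im] := eqVneq (c ord0 i) 0.
have topE (j j' : 'I_m) : Bt (widen_ord (ltnW hmn) j) j' = (j == j')%:R.
  by have /matrixP/(_ j j') := top1; rewrite !mxE.
have iE : i = widen_ord (ltnW hmn) (Ordinal im) by apply: val_inj.
have /rowP/(_ (Ordinal im)) := cBt0; rewrite !mxE (bigD1 i)//= {2}iE topE eqxx.
rewrite mulr1 big1 ?addr0// => k ki.
have [->|/cm km] := eqVneq (c ord0 k) 0; first by rewrite mul0r.
have kE : k = widen_ord (ltnW hmn) (Ordinal km) by apply: val_inj.
rewrite [X in Bt X _]kE topE (_ : (_ == _) = false) ?mulr0//.
by apply: contraNF ki => /eqP[ki]; apply/eqP/val_inj.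
Qed.

(** The points of the line fall into three classes: those whose spectra all
    have an index among the first m, where the identity block gives
    independence; those of one spectrum with another index, where that row
    is nonzero; and those of an overlap that involves another index. On such an
    overlap all the rows of index in chi are nonzero, so that deleting zero
    rows removes exactly the rows of index outside chi, and the rank condition
    is the independence of the remaining ones. *)
Lemma pointwise_freeP (n m : nat) (hmn : (m < n)%N) (K : set R)
    (lam : 'rV[R]_n) (Bt : 'M[R]_(n, m)) :
  K !=set0 -> top_rows hmn Bt = 1%:M ->
  pointwise_free (spectrum K lam) Bt <->
  (forall k : 'I_n, (m <= k)%N -> row_support Bt k != finset.set0) /\
  (overlaps_bar m K lam = set0 \/
   (overlaps_bar m K lam !=set0 /\
    forall S : set R, overlaps_bar m K lam S ->
      \rank (Mbar K lam Bt S) = pr K lam Bt S /\ (pr K lam Bt S <= m)%N)).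
Proof.
move=> [b Kb] top1; split=> [free|[rows overl]].
  split=> [k _|].
    apply: contraTneq isT => supp0; pose c : 'rV[R]_n := delta_mx ord0 k.
    suff : c = 0.
      by move=> /rowP/(_ k); rewrite !mxE !eqxx => /eqP; rewrite oner_eq0.
    apply: (free (lam ord0 k * b)).
      move=> i; rewrite mxE eqxx /=; have [-> _|_] := eqVneq i k; last first.
        by rewrite eqxx.
      by exists b.
    rewrite -rowE; apply/rowP => j; rewrite !mxE; apply/eqP.
    by have /setP/(_ j) := supp0; rewrite !inE => /negbFE.
  have [Sbar|] := pselect (overlaps_bar m K lam !=set0); last first.
    by move=> /nonemptyPn; left.
  right; split=> // S [[I [_ [x Ix] SI]] _].
  suff Mfree : row_free (Mbar K lam Bt S).
    by split; [exact/eqP|rewrite -(eqP Mfree) rank_leq_col].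
  apply: row_free_delete_zero_rows => c cM cM0.
  have chi_c i : c ord0 i != 0 -> i \in chi K lam S.
    move=> /cM; rewrite inE; apply: contraR => iS; apply/eqP/rowP => j.
    by rewrite /Mr /Emx mul_diag_mx !mxE (negbTE iS) mul0r.
  apply: (free x); last by rewrite -[c](mul_Emx_id chi_c) -mulmxA.
  by move=> i /chi_c; rewrite SI (chi_overlap_set Ix) => /(Ix i).
have rows_nz (k : 'I_n) : row k Bt != 0.
  have [mk|km] := leqP m k.
    apply: contraNneq (rows k mk) => rk0; apply/eqP/setP => j.
    by rewrite !inE; have /rowP/(_ j) := rk0; rewrite !mxE => ->; rewrite eqxx.
  have kE : k = widen_ord (ltnW hmn) (Ordinal km) by apply: val_inj.
  apply/eqP => /rowP/(_ (Ordinal km)); have /matrixP/(_ (Ordinal km)) := top1.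
  move=> /(_ (Ordinal km)); rewrite !mxE -kE eqxx => -> /eqP.
  by rewrite oner_eq0.
move=> x c cx cBt0.
pose I := [set i | `[< spectrum K lam i x >]]%SET.
have cI i : c ord0 i != 0 -> i \in I.
  by move=> /cx ?; rewrite inE; exact/asboolP.
have [Im|] := boolP [forall i in I, (i < m)%N].
  by apply: (identity_rows_free top1) cBt0 => i /cI; move/forall_inP: Im; apply.
rewrite negb_forall_in => /exists_inP[i0 i0I]; rewrite -leqNgt => mi0.
have [I2|I1] := leqP 2 #|I|; last first.
  have cE i : i != i0 -> c ord0 i = 0.
    move=> ii0; apply/eqP; apply: contraTT I1 => /cI iI; rewrite -leqNgt.
    by rewrite (cardsD1 i0) i0I (cardsD1 i) in_setD1 ii0 iI.
  apply/rowP => i; rewrite mxE; have [->|/cE//] := eqVneq i i0.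
  have /eqP : c ord0 i0 *: row i0 Bt = 0.
    rewrite -[RHS]cBt0; apply/rowP => j.
    rewrite !mxE (bigD1 i0)//= big1 ?addr0//.
    by move=> i1 /cE ->; rewrite mul0r.
  by rewrite scaler_eq0 (negbTE (rows_nz _)) orbF => /eqP.
have Ix : overlap_set K lam I x by move=> j; rewrite inE; split=> /asboolP.
pose S := overlap_set K lam I.
have chiS : chi K lam S = I := chi_overlap_set Ix.
have Sbar : overlaps_bar m K lam S.
  split; first by exists I; split => //; exists x.
  by rewrite chiS (leq_trans _ (leq_bigmax_cond _ i0I)).
case: overl => [Sbar0|[_ /(_ S Sbar)[rankS _]]]; first by rewrite Sbar0 in Sbar.
have Mfree : row_free (Mbar K lam Bt S) by rewrite /row_free rankS.
pose v := \row_(k < #|nonzero_rows (Mr K lam Bt S)|) c ord0 (enum_val k).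
have v0 : v = 0.
  apply/eqP; rewrite -(mulmx_free_eq0 _ Mfree) mul_delete_zero_rows.
  by rewrite /Mr mulmxA mul_Emx_id ?cBt0 ?chiS.
apply/rowP => i; rewrite mxE; apply/eqP; apply/negPn/negP => ci.
have iM : i \in nonzero_rows (Mr K lam Bt S).
  rewrite inE; apply: contra (rows_nz i) => /eqP/rowP ri0; apply/eqP/rowP => j.
  by have := ri0 j; rewrite /Mr /Emx mul_diag_mx !mxE chiS (cI i ci) mul1r.
have /rowP/(_ (enum_rank_in iM i)) := v0.
by rewrite !mxE enum_rankK_in// => /eqP; exact/negP.
Qed.

End RankCondition.

(** * The criterion *)

Section Factorization.
Variable R : realType.

Lemma top_rows_Btilde (n m : nat) (hmn : (m < n)%N) (P : 'M[R]_n)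
    (B : 'M[R]_(n, m)) :
  B0 hmn P B \in unitmx -> top_rows hmn (Btilde hmn P B) = 1%:M.
Proof.
by move=> unitB0; rewrite /top_rows -mul_rowsub_mx -/(top_rows _ _) mulmxV.
Qed.

Lemma Btilde_factor (n m : nat) (hmn : (m < n)%N) (P : 'M[R]_n)
    (B : 'M[R]_(n, m)) :
  P \in unitmx -> B0 hmn P B \in unitmx ->
  B = P *m Btilde hmn P B *m B0 hmn P B.
Proof.
by move=> unitP unitB0; rewrite /Btilde -!mulmxA mulVmx// mulmx1 mulKVmx.
Qed.

Lemma full_rank_eigenvalues_neq0 (n : nat) (A P : 'M[R]_n) (lam : 'rV[R]_n) :
  \rank A = n -> A = P *m diag_mx lam *m invmx P ->
  forall i, lam ord0 i != 0.
Proof.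
move=> rankA diagA i.
have : A \in unitmx by rewrite -row_free_unit /row_free rankA.
rewrite diagA !unitmx_mul => /andP[/andP[_ +] _].
by rewrite unitmxE det_diag unitfE => /prodf_neq0/(_ i isT).
Qed.

End Factorization.

Unset Implicit Arguments.
Set Strict Implicit.
Set Printing Implicit Defensive.

Theorem theorem2 (R : realType) (n m : nat) (hmn : (m < n)%N)
    (beta1 beta2 : R) (hbeta : beta1 < beta2)
    (K : set R) (defK : K = `[beta1, beta2]%classic)
    (hK : K `<=` `]0, +oo[ \/ K `<=` `]-oo, 0[)
    (A : 'M[R]_n) (B : 'M[R]_(n, m))
    (rankA : \rank A = n) (rankB : \rank B = m)
    (P : 'M[R]_n) (lam : 'rV[R]_n)
    (unitP : P \in unitmx) (diagA : A = P *m diag_mx lam *m invmx P)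
    (unitB0 : B0 hmn P B \in unitmx) :
  uniformly_ensemble_controllable K A B <->
  (forall k : 'I_n, (m <= k)%N ->
     row_support (Btilde hmn P B) k != finset.set0) /\
  (overlaps_bar m K lam = set0 \/
   (overlaps_bar m K lam !=set0 /\
    forall S : set R, overlaps_bar m K lam S ->
      \rank (Mbar K lam (Btilde hmn P B) S)
        = pr K lam (Btilde hmn P B) S /\
      (pr K lam (Btilde hmn P B) S <= m)%N)).
Proof.
have factB := Btilde_factor unitP unitB0.
have K0 : K !=set0 by exists beta1; rewrite defK /= in_itv /= lexx ltW.
rewrite -(pointwise_freeP lam K0 (top_rows_Btilde unitB0)).
split; first exact: controllable_pointwise_free unitP diagA factB.
have Kn0 b : beta1 <= b <= beta2 -> b != 0.
  move=> bK; have Kb : K b by rewrite defK /= in_itv.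
  case: hK => /(_ b Kb); rewrite /= in_itv /= ?andbT.
    by move/gt_eqF => ->.
  by move/lt_eqF => ->.
rewrite defK.
apply: (pointwise_free_controllable (ltW hbeta) Kn0 _ unitP unitB0) => //.
exact: full_rank_eigenvalues_neq0 rankA diagA.
Qed.
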